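(* Let $\mathrm B$ be an aggregation function on $\mathsf{Int}_{[0,1]}$ such that the pair $(\mathrm K_{0.5},\mathrm B)$ is admissible. If $\preceq_{\mathrm K_{0.5},\mathrm B}$ coincides with the $(0.5,1)$-order (resp., the $(0.5,0)$-order), then $\mathrm B$ is Schur-convex (resp., Schur-concave). Moreover, if $\mathrm B$ is strictly Schur-convex (resp., strictly Schur-concave), then $\preceq_{\mathrm K_{0.5},\mathrm B}$ coincides with the $(0.5,1)$-order (resp., the $(0.5,0)$-order).
   Context: Let $\mathsf{Int}_{[0,1]}=\{[a_1,a_2]: 0\le a_1\le a_2\le 1\}$ (degenerate intervals allowed); write $\mathbf u=[u_1,u_2]$. The interval order is: $\mathbf u\preceq_{\mathrm{Int}}\mathbf x$ iff $u_1\le x_1$ and $u_2\le x_2$. An admissible order is a total order $\preceq$ on $\mathsf{Int}_{[0,1]}$ such that $\mathbf u\preceq_{\mathrm{Int}}\mathbf x$ implies $\mathbf u\preceq\mathbf x$. An aggregation function (AF) is a function $\mathrm A\colon\mathsf{Int}_{[0,1]}\to[0,1]$ with $\mathrm A([0,0])=0$, $\mathrm A([1,1])=1$, and $\mathrm A(\mathbf u)\le\mathrm A(\mathbf x)$ whenever $u_1\le x_1$ and $u_2\le x_2$. For a pair $(\mathrm A,\mathrm B)$ of AFs, the relation $\preceq_{\mathrm A,\mathrm B}$ is defined by: $\mathbf u\preceq_{\mathrm A,\mathrm B}\mathbf x$ iff $\mathrm A(\mathbf u)<\mathrm A(\mathbf x)$, or $\mathrm A(\mathbf u)=\mathrm A(\mathbf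 x)$ and $\mathrm B(\mathbf u)\le\mathrm B(\mathbf x)$. The pair $(\mathrm A,\mathrm B)$ is admissible if $\preceq_{\mathrm A,\mathrm B}$ is an admissible order. For $w\in[0,1]$, $\mathrm K_w([z_1,z_2])=(1-w)z_1+wz_2$. For $\alpha,\beta\in[0,1]$ with $\alpha\ne\beta$, the $(\alpha,\beta)$-order is the relation $\preceq_{(\alpha,\beta)}$ given by: $\mathbf u\preceq_{(\alpha,\beta)}\mathbf x$ iff $\mathrm K_\alpha(\mathbf u)<\mathrm K_\alpha(\mathbf x)$, or $\mathrm K_\alpha(\mathbf u)=\mathrm K_\alpha(\mathbf x)$ and $\mathrm K_\beta(\mathbf u)\le\mathrm K_\beta(\mathbf x)$. Two relations on $\mathsf{Int}_{[0,1]}$ coincide if they are equal as relations. A function $\mathrm F\colon\mathsf{Int}_{[0,1]}\to\mathbb R$ is Schur-convex (resp., Schur-concave) if $\mathrm F(\mathbf u)\le\mathrm F(\mathbf x)$ (resp., $\mathrm F(\mathbf u)\ge\mathrm F(\mathbf x)$) for all $\mathbf u,\mathbf x\in\mathsf{Int}_{[0,1]}$ with $u_1+u_2=x_1+x_2$ and $u_2\le x_2$. It is strictly Schur-convex (resp., strictly Schur-concave) if the inequality is strict whenever $u_1+u_2=x_1+x_2$ and $u_2<x_2$. *)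

(* Defs.v *)
From mathcomp Require Import all_boot all_order all_algebra reals.
Set Implicit Arguments.
Unset Strict Implicit.
Unset Printing Implicit Defensive.
Import Order.TTheory GRing.Theory Num.Theory.
Local Open Scope ring_scope.

(* The order conditions are boolean, so their proofs are irrelevant and two
   intervals are Leibniz-equal as soon as their endpoints are. *)
Record Int01 (R : realType) := MkInt01 {
  lo : R;
  hi : R;
  Int01P : [&& 0 <= lo, lo <= hi & hi <= 1] }.

Lemma int00_subproof (R : realType) :
  [&& (0 : R) <= 0, (0 : R) <= 0 & (0 : R) <= 1].
Proof. by rewrite lexx ler01. Qed.

Lemma int11_subproof (R : realType) :
  [&& (0 : R) <= 1, (1 : R) <= 1 & (1 : R) <= 1].
Proof. by rewrite lexx ler01. Qed.

Definition int00 (R : realType) : Int01 R := MkInt01 (int00_subproof R).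
Definition int11 (R : realType) : Int01 R := MkInt01 (int11_subproof R).

Definition le_Int (R : realType) : rel (Int01 R) :=
  fun u x => (lo u <= lo x) && (hi u <= hi x).

Definition total_order (T : Type) (r : rel T) : Prop :=
  [/\ reflexive r, antisymmetric r, transitive r & total r].

Definition admissible_order (R : realType) (r : rel (Int01 R)) : Prop :=
  total_order r /\ forall u x : Int01 R, le_Int u x -> r u x.

Definition aggregation_function (R : realType) (A : Int01 R -> R) : Prop :=
  [/\ forall u : Int01 R, 0 <= A u <= 1,
      A (int00 R) = 0,
      A (int11 R) = 1 &
      forall u x : Int01 R, lo u <= lo x -> hi u <= hi x -> A u <= A x].

Definition lex_rel (R : realType) (A B : Int01 R -> R) : rel (Int01 R) :=
  fun u x => (A u < A x) || ((A u == A x) && (B u <= B x)).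

Definition admissible_pair (R : realType) (A B : Int01 R -> R) : Prop :=
  [/\ aggregation_function A, aggregation_function B &
      admissible_order (lex_rel A B)].

Definition K (R : realType) (w : R) : Int01 R -> R :=
  fun z => (1 - w) * lo z + w * hi z.

Lemma K_aggregation_function (R : realType) (w : R) :
  0 <= w <= 1 -> aggregation_function (K w).
Proof.
move=> /andP[w0 w1]; have w1' : 0 <= 1 - w by rewrite subr_ge0.
have mono (a b c d : R) : a <= c -> b <= d ->
    (1 - w) * a + w * b <= (1 - w) * c + w * d.
  by move=> ac bd; apply: lerD; apply: ler_wpM2l.
split=> [u|||u x]; rewrite /K /= ?mulr0 ?mulr1 ?addr0 ?subrK //; last exact: mono.
have /and3P[l0 lh h1] := Int01P u.
apply/andP; split; first by rewrite addr_ge0 ?mulr_ge0 // (le_trans l0).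
by have := mono _ _ _ _ (le_trans lh h1) h1; rewrite !mulr1 subrK.
Qed.

(* Meant for distinct alpha and beta in [0, 1]. *)
Definition alpha_beta_order (R : realType) (alpha beta : R) : rel (Int01 R) :=
  lex_rel (K alpha) (K beta).

Definition Schur_convex (R : realType) (F : Int01 R -> R) : Prop :=
  forall u x : Int01 R,
    lo u + hi u = lo x + hi x -> hi u <= hi x -> F u <= F x.

Definition Schur_concave (R : realType) (F : Int01 R -> R) : Prop :=
  forall u x : Int01 R,
    lo u + hi u = lo x + hi x -> hi u <= hi x -> F x <= F u.

(* Strictness already implies the non-strict property: equal sums and equal
   upper endpoints force u = x. *)
Definition strictly_Schur_convex (R : realType) (F : Int01 R -> R) : Prop :=
  forall u x : Int01 R,
    lo u + hi u = lo x + hi x -> hi u < hi x -> F u < F x.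

Definition strictly_Schur_concave (R : realType) (F : Int01 R -> R) : Prop :=
  forall u x : Int01 R,
    lo u + hi u = lo x + hi x -> hi u < hi x -> F x < F u.

(* Main.v *)
Require Import Defs.
From mathcomp Require Import all_boot all_order all_algebra reals.
From mathcomp Require Import ring lra.
Import Order.TTheory GRing.Theory Num.Theory.
Local Open Scope ring_scope.

(** Both orders compare [K 2^-1] first, so they can differ only between intervals with the same
    midpoint ([eq_K_half]). They coincide exactly when, on each such fibre, [B] ranks intervals as
    the second key [hi] or [lo] does ([eq_lex_rel]). On a fibre [hi] determines the interval and
    [lo] falls as [hi] grows, so Schur-convexity is monotonicity of [B] in [hi], and Schur-concavity
    is monotonicity in [lo]. *)

Lemma Int01_eq (R : realType) (u x : Int01 R) :
  lo u = lo x -> hi u = hi x -> u = x.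
Proof.
case: u x => [a b p] [c d q] /= eac ebd; subst c d.
by rewrite (bool_irrelevance p q).
Qed.

Lemma K0E (R : realType) (u : Int01 R) : K 0 u = lo u.
Proof. by rewrite /K; ring. Qed.

Lemma K1E (R : realType) (u : Int01 R) : K 1 u = hi u.
Proof. by rewrite /K; ring. Qed.

Lemma eq_K_half (R : realType) (u x : Int01 R) :
  K 2^-1 u = K 2^-1 x <-> lo u + hi u = lo x + hi x.
Proof. by rewrite /K; split=> h; lra. Qed.

(** Off the ties of [A], both sides are decided by [A] alone; on a tie only the second key
    remains. *)
Lemma eq_lex_rel (R : realType) (A B C : Int01 R -> R) :
  lex_rel A B =2 lex_rel A C <->
  forall u x, A u = A x -> (B u <= B x) = (C u <= C x).
Proof.
split=> [h u x Aux | h u x]; first by have := h u x; rewrite /lex_rel Aux ltxx eqxx.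
by rewrite /lex_rel; case: eqP => //= Aux; rewrite (h _ _ Aux).
Qed.

Theorem proposition5p1 (R : realType) (B : Int01 R -> R)
    (hB : aggregation_function B) (hKB : admissible_pair (K 2^-1) B) :
  [/\ lex_rel (K 2^-1) B =2 alpha_beta_order 2^-1 1 -> Schur_convex B,
      lex_rel (K 2^-1) B =2 alpha_beta_order 2^-1 0 -> Schur_concave B,
      strictly_Schur_convex B ->
        lex_rel (K 2^-1) B =2 alpha_beta_order 2^-1 1 &
      strictly_Schur_concave B ->
        lex_rel (K 2^-1) B =2 alpha_beta_order 2^-1 0].
Proof.
split.
- move=> /eq_lex_rel h u x sux hux.
  by rewrite h ?K1E //; apply/eq_K_half.
- move=> /eq_lex_rel h u x sux hux.
  (* With equal sums, [hi u <= hi x] amounts to [lo x <= lo u]. *)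
  by rewrite h ?K0E; [lra | apply/eq_K_half].
- move=> hc; apply/eq_lex_rel => u x /eq_K_half sux; rewrite !K1E.
  (* By trichotomy, strict monotonicity along a fibre also reflects the order; a tie forces
     [u = x]. *)
  have [lt_ux|lt_xu|eq_ux] := ltgtP (hi u) (hi x).
  + by rewrite ltW // hc.
  + by rewrite leNgt hc.
  + by rewrite (@Int01_eq _ u x) ?lexx //; lra.
- move=> hc; apply/eq_lex_rel => u x /eq_K_half sux; rewrite !K0E.
  have [lt_ux|lt_xu|eq_ux] := ltgtP (lo u) (lo x).
  + by rewrite ltW // hc //; lra.
  + by rewrite leNgt hc //; lra.
  + by rewrite (@Int01_eq _ u x) ?lexx //; lra.
Qed.
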